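(* Let $n\ge2$, let $H$ be a group and let $h_1,\ldots,h_n$ be elements of $H$. Write $\mathfrak{b}=\{h_1,\ldots,h_n\}$. The following are equivalent: (1) $\mathfrak{b}$ is a $P(f_H)$-basis of the group $H$; (2) there are a nonzero commutative associative ring $R$ with unit and symmetric 2-cocycles $f^i:R^+\times R^+\to\bigoplus_{1\le j<k\le n}R^+$, $1\le i\le n$, and a group isomorphism $\varphi:G=N_{2,n}(R,f^1,\ldots,f^n)\to H$ with $\varphi(g_i)=h_i$ for all $1\le i\le n$, where $\{g_1,\ldots,g_n\}$ is the standard basis of $G$. Moreover, if (1) holds, the ring $R$ and the symmetric 2-cocycles $f^i$ in (2) can be constructed such that, for each $1\le i\le n$, the centralizer $H_i=C_H(h_i)$ is an abelian extension of $\bigoplus_{1\le j<k\le n}R^+$ by $R^+$ via the symmetric 2-cocycle $f^i$.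
   Context: Commutators: $[x,y]=x^{-1}y^{-1}xy$; $[A,B]$ is the subgroup generated by all $[a,b]$, $a\in A,b\in B$ (and $[h,B]=[\{h\},B]$). Basis. Let $H$ be a group with distinct nontrivial elements $h_1,\ldots,h_n$. Then $\{h_1,\ldots,h_n\}$ is a basis for $H$ if there are subgroups $H_i$ ($1\le i\le n$), $H_{ij}$ ($1\le i<j\le n$) of $H$ with: (1) $H_i=C_H(h_i)$ and $H_{ij}=[h_i,H_j]=[H_i,h_j]=[H_i,H_j]$ for $i<j$; (2) $H_i\cap H_j=Z(H)$ for $i<j$; (3) $[H_i,H_i]=1$; (4) $[H,H]\subseteq Z(H)$; (5)(a) every element of $H$ can be written as $u_nu_{n-1}\cdots u_1v$ with $u_i\in H_i$, $v\in Z(H)$, and each $u_i$ is unique modulo $Z(H)$; (5)(b) each $v\in Z(H)$ can be uniquely written as $u_{12}\cdots u_{1n}u_{23}\cdots u_{n-1,n}$ with $u_{ij}\in H_{ij}$. (In this case $Z(H)=[H,H]$.) For such $H$, $f_H:H/Z(H)\times H/Z(H)\to Z(H)$ is the bilinear map $(xZ(H),yZ(H))\mapsto[x,y]$, and $P(f_H)$ is the commutative associative unital ring of all pairs $(\phi_1,\phi_0)\in \mathrm{End}(H/Z(H))\times\mathrm{End}(Z(H))$ satisfying $f_H(\phi_1(u),w)=f_H(u,\phi_1(w))=\phi_0(f_H(u,w))$ for all $u,w\in H/Z(H)$, with coordinatewise (pointwise) addition and composition. It acts on $H/Z(H)$ via $\phi_1$ and on $Z(H)$ via $\phi_0$. $P(f_H)$-basis.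 $\{h_1,\ldots,h_n\}$ is a $P(f_H)$-basis for $H$ if it is a basis for $H$ and, for every $i$, $H_i/Z(H)$ is a cyclic $P(f_H)$-module generated by $h_iZ(H)$. Cocycles. $R^+$ is the additive group of $R$. For abelian groups $A,B$ a 2-cocycle is $f:B\times B\to A$ with $f(0,x)=f(x,0)=0$ and $f(x+y,z)+f(x,y)=f(x,y+z)+f(y,z)$; it is symmetric if $f(x,y)=f(y,x)$. A group $E$ is an (abelian) extension of $A$ by $B$ via a symmetric 2-cocycle $f$ if $E$ is isomorphic to $B\times A$ with multiplication $(b_1,a_1)(b_2,a_2)=(b_1+b_2,a_1+a_2+f(b_1,b_2))$. Groups. For symmetric 2-cocycles $f^i$ as in (2), with coordinates $f^i_{jk}$, $N_{2,n}(R,f^1,\ldots,f^n)$ is the set of tuples $((\alpha_i)_{1\le i\le n},(\gamma_{ij})_{1\le i<j\le n})$ over $R$ with multiplication $$((\alpha_i),(\gamma_{ij}))\odot((\beta_i),(\gamma'_{ij}))=\Big((\alpha_i+\beta_i),\big(\gamma_{ij}+\gamma'_{ij}+\alpha_i\beta_j+\sum_{k=1}^n f^k_{ij}(\alpha_k,\beta_k)\big)\Big).$$ Its standard basis is $\{g_1,\ldots,g_n\}$, where $g_i$ has $\alpha_i=1$ and all other coordinates $0$. *)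

(* Defs.v *)
From HB Require Import structures.
From mathcomp Require Import all_boot all_algebra.
From mathcomp Require Import generic_quotient ring.
From mathcomp Require Import boolp classical_sets.

Set Implicit Arguments.
Unset Strict Implicit.
Unset Printing Implicit Defensive.

Import GRing.Theory.
Local Open Scope group_scope.
Local Open Scope quotient_scope.
Local Open Scope classical_set_scope.

Definition is_subgroup (H : groupType) (A : set H) : Prop :=
  group_closed (mem A).

Record subgroup (H : groupType) := Subgroup {
  sgset :> set H;
  sgsetP : is_subgroup sgset
}.

Definition sgtype (H : groupType) (A : subgroup H) : Type :=
  {x : H | x \in sgset A}.

HB.instance Definition _ (H : groupType) (A : subgroup H) :=
  SubChoice.on (sgtype A).
HB.instance Definition _ (H : groupType) (A : subgroup H) :=
  SubChoice_isSubGroup.Build H (fun x => x \in sgset A) (sgtype A) (sgsetP A).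

Section GroupNotions.
Variable H : groupType.
Implicit Types (A B : set H) (x y z : H).

Lemma is_subgroupP A : is_subgroup A <->
  A 1 /\ (forall x y, A x -> A y -> A (x / y)).
Proof.
rewrite /is_subgroup; split=> -[A1 AV].
  split=> [|x y Ax Ay]; first exact: set_mem A1.
  by apply/set_mem/AV; apply/mem_set.
split=> [|x y /set_mem Ax /set_mem Ay]; first exact: mem_set.
exact/mem_set/AV.
Qed.

Lemma generated_subproof A : is_subgroup (smallest (@is_subgroup H) A).
Proof.
apply/is_subgroupP; split=> [B [/is_subgroupP[]] //|x y Ax Ay B BP].
case: (BP) => /is_subgroupP[_ BV] _.
by apply: BV; [apply: Ax | apply: Ay].
Qed.

Definition generated A : subgroup H := Subgroup (generated_subproof A).

Definition commg_sg A B : subgroup H :=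
  generated [set z | exists x y, [/\ A x, B y & z = [~ x, y]]].

Lemma centraliser_subproof x : is_subgroup [set y | commute x y].
Proof.
apply/is_subgroupP; split=> [|y z xy xz]; first exact: commute1.
by apply: commuteM => //; apply: commuteV.
Qed.

Definition centraliser x : subgroup H := Subgroup (centraliser_subproof x).

Lemma center_subproof : is_subgroup [set z | forall x, commute x z].
Proof.
apply/is_subgroupP; split=> [x|y z Zy Zz x]; first exact: commute1.
by apply: commuteM => //; apply: commuteV.
Qed.

Definition center : subgroup H := Subgroup center_subproof.

Definition eqmodZ x y : bool := x^-1 * y \in sgset center.

Lemma eqmodZ_equiv : equiv_class_of eqmodZ.
Proof.
have /is_subgroupP[Z1 ZV] := sgsetP center.
have eqV x y : eqmodZ x y -> eqmodZ y x.
  move=> /set_mem xy; apply/mem_set.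
  by have := ZV _ _ Z1 xy; rewrite mul1g invgM invgK.
split=> [x|x y|y x z xy yz]; first by apply/mem_set; rewrite mulVg.
  by apply/idP/idP; apply: eqV.
have /set_mem yx := eqV _ _ xy; move/set_mem: yz => yz.
apply/mem_set; have := ZV _ _ (set_mem xy) (set_mem (eqV _ _ (mem_set yz))).
by rewrite invgM invgK -mulgA mulVKg.
Qed.

Canonical eqmodZ_equiv_rel := EquivRelPack eqmodZ_equiv.

(* H / Z(H); for left cosets: x and y are identified when x^-1 y is central *)
Definition quoZ : Type := {eq_quot eqmodZ}.
HB.instance Definition _ := Choice.on quoZ.
HB.instance Definition _ := EqQuotient.on quoZ.

Definition cosetZ x : quoZ := \pi_quoZ x.

Definition quoZ_mul (u v : quoZ) : quoZ := cosetZ (repr u * repr v).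
Definition quoZ_one : quoZ := cosetZ 1.
Definition quoZ_inv (u : quoZ) : quoZ := cosetZ (repr u)^-1.

Lemma centerP z : sgset center z <-> (forall x, x * z = z * x).
Proof. by []. Qed.

Lemma cosetZ_eq x y : cosetZ x = cosetZ y <-> sgset center (x^-1 * y).
Proof.
rewrite /cosetZ; split=> [/eqmodP/set_mem //|xy].
by apply/eqmodP/mem_set.
Qed.

Lemma repr_cosetZ x : exists2 z, sgset center z & repr (cosetZ x) = x * z.
Proof.
exists (x^-1 * repr (cosetZ x)); last by rewrite mulVKg.
by apply/cosetZ_eq; rewrite /cosetZ reprK.
Qed.

Lemma cosetZ_repr (u : quoZ) : cosetZ (repr u) = u.
Proof. exact: reprK. Qed.

Lemma cosetZ_mulr x z : sgset center z -> cosetZ (x * z) = cosetZ x.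
Proof. by move=> Zz; apply/esym/cosetZ_eq; rewrite mulKg. Qed.

Lemma quoZ_mulE x y : quoZ_mul (cosetZ x) (cosetZ y) = cosetZ (x * y).
Proof.
rewrite /quoZ_mul; have [z Zz ->] := repr_cosetZ x.
have [t Zt ->] := repr_cosetZ y.
have -> : x * z * (y * t) = x * y * z * t.
  by rewrite !mulgA -(mulgA x z) -(mulgA x y); congr (_ * _ * _); rewrite Zz.
by rewrite 2?cosetZ_mulr.
Qed.

Lemma quoZ_invE x : quoZ_inv (cosetZ x) = cosetZ x^-1.
Proof.
rewrite /quoZ_inv; have [z Zz ->] := repr_cosetZ x.
by apply/cosetZ_eq; rewrite invgK Zz mulgK.
Qed.

Lemma cosetZ_surj (u : quoZ) : exists x, u = cosetZ x.
Proof. by exists (repr u); rewrite cosetZ_repr. Qed.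

Lemma quoZ_mulA : associative quoZ_mul.
Proof.
move=> u v w; have [x ->] := cosetZ_surj u; have [y ->] := cosetZ_surj v.
by have [z ->] := cosetZ_surj w; rewrite !quoZ_mulE mulgA.
Qed.

Lemma quoZ_mul1 : left_id quoZ_one quoZ_mul.
Proof. by move=> u; have [x ->] := cosetZ_surj u; rewrite quoZ_mulE mul1g. Qed.

Lemma quoZ_mulr1 : right_id quoZ_one quoZ_mul.
Proof. by move=> u; have [x ->] := cosetZ_surj u; rewrite quoZ_mulE mulg1. Qed.

Lemma quoZ_mulV : left_inverse quoZ_one quoZ_inv quoZ_mul.
Proof. by move=> u; have [x ->] := cosetZ_surj u; rewrite quoZ_invE quoZ_mulE mulVg. Qed.

Lemma quoZ_mulrV : right_inverse quoZ_one quoZ_inv quoZ_mul.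
Proof. by move=> u; have [x ->] := cosetZ_surj u; rewrite quoZ_invE quoZ_mulE mulgV. Qed.

HB.instance Definition _ := isGroup.Build quoZ
  quoZ_mulA quoZ_mul1 quoZ_mulr1 quoZ_mulV quoZ_mulrV.

Lemma cosetZM x y : cosetZ (x * y) = cosetZ x * cosetZ y.
Proof. by rewrite -quoZ_mulE. Qed.

Lemma commgZ x y z t : sgset center z -> sgset center t ->
  [~ x * z, y * t] = [~ x, y].
Proof.
have cZ a b c : sgset center c -> [~ a * c, b] = [~ a, b].
  move=> Zc; apply: (@mulgI _ (b * (a * c))); rewrite -commgC.
  have -> : b * (a * c) * [~ a, b] = b * a * [~ a, b] * c.
    by rewrite -2!mulgA -(mulgA _ _ c) (Zc [~ a, b]) !mulgA.
  by rewrite -commgC -!mulgA Zc.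
move=> Zz Zt; rewrite cZ //; apply: invg_inj.
by rewrite !invgR cZ.
Qed.

(* f_H is only meant for groups with [H, H] <= Z(H); the default value 1 is
   then never used, and the choice of representatives is irrelevant: see
   fHE. *)
Definition fH (u w : quoZ) : sgtype center :=
  insubd (1 : sgtype center) [~ repr u, repr w].

Lemma fHE x y : sgset center [~ x, y] -> val (fH (cosetZ x) (cosetZ y)) = [~ x, y].
Proof.
move=> Zxy; have [z Zz ez] := repr_cosetZ x; have [t Zt et] := repr_cosetZ y.
by rewrite /fH ez et commgZ // insubdK //; apply/mem_set.
Qed.

(* The underlying set of the ring P(f_H); its sum is pointwise in the abelian
   groups H / Z(H) and Z(H), and its product is composition. *)
Definition PfH : set ({multiplicative quoZ -> quoZ} *
                      {multiplicative sgtype center -> sgtype center})%type :=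
  [set phi : {multiplicative quoZ -> quoZ} *
             {multiplicative sgtype center -> sgtype center} |
    forall u w, fH (phi.1 u) w = fH u (phi.1 w) /\
                fH u (phi.1 w) = phi.2 (fH u w)].

(* P(f_H) is unital, so the cyclic module generated by u is P(f_H) . u. *)
Definition cyclic_PfH_module (M : set quoZ) (u : quoZ) : Prop :=
  M = [set phi.1 u | phi in PfH].

(* The families u and the subgroups H_ij below are indexed by all pairs of
   indices, but only their values for i < j matter. *)
Definition is_basis_for (n : nat) (h : 'I_n -> H)
    (Hi : 'I_n -> subgroup H) (Hij : 'I_n -> 'I_n -> subgroup H) : Prop :=
  let decomp5a (u : 'I_n -> H) (v x : H) :=
    [/\ forall i, sgset (Hi i) (u i), sgset center v &
       x = (\prod_(i < n) u (rev_ord i)) * v] in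
  let decomp5b (u : 'I_n -> 'I_n -> H) (v : H) :=
    (forall i j : 'I_n, (i < j)%N -> sgset (Hij i j) (u i j)) /\
    v = \prod_(i < n) \prod_(j < n | (i < j)%N) u i j in
  [/\ (forall i, Hi i = centraliser (h i) :> set H) /\
        (forall i j : 'I_n, (i < j)%N ->
          [/\ Hij i j = commg_sg [set h i] (Hi j) :> set H,
              Hij i j = commg_sg (Hi i) [set h j] :> set H &
              Hij i j = commg_sg (Hi i) (Hi j) :> set H]),
      forall i j : 'I_n, (i < j)%N -> Hi i `&` Hi j = center :> set H,
      forall i, commg_sg (Hi i) (Hi i) = [set 1] :> set H,
      commg_sg setT setT `<=` center &
      [/\ forall x, exists u v, decomp5a u v x,
          forall x u v u' v', decomp5a u v x -> decomp5a u' v' x ->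
            forall i, cosetZ (u i) = cosetZ (u' i),
          forall v, sgset center v -> exists u, decomp5b u v &
          forall v u u', sgset center v -> decomp5b u v -> decomp5b u' v ->
            forall i j : 'I_n, (i < j)%N -> u i j = u' i j]].

Definition is_basis (n : nat) (h : 'I_n -> H) : Prop :=
  [/\ injective h, forall i, h i <> 1 &
      exists Hi Hij, is_basis_for h Hi Hij].

Definition is_PfH_basis (n : nat) (h : 'I_n -> H) : Prop :=
  is_basis h /\
  forall i, cyclic_PfH_module
    [set cosetZ x | x in sgset (centraliser (h i))] (cosetZ (h i)).

End GroupNotions.

Local Close Scope group_scope.
Local Open Scope ring_scope.

Record sym_cocycle (B A : zmodType) := SymCocycle {
  cocycle :> B -> B -> A;
  cocycle0x : forall x, cocycle 0 x = 0;
  cocyclex0 : forall x, cocycle x 0 = 0;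
  cocycleA : forall x y z,
    cocycle (x + y) z + cocycle x y = cocycle x (y + z) + cocycle y z;
  cocycleC : forall x y, cocycle x y = cocycle y x
}.

(* The cocycle is a phantom parameter of the carrier; it determines the group
   structure declared below, which is not the componentwise one. *)
Definition extension_of (B A : zmodType) (f : sym_cocycle B A) : Type :=
  (B * A)%type.

Section Extension.
Variables (B A : zmodType) (f : sym_cocycle B A).

Local Notation extension := (extension_of f).
HB.instance Definition _ := Choice.on extension.

Definition ext_mul (x y : extension) : extension :=
  (x.1 + y.1, x.2 + y.2 + f x.1 y.1).
Definition ext_one : extension := (0, 0).
Definition ext_inv (x : extension) : extension :=
  (- x.1, - x.2 - f x.1 (- x.1)).

Lemma ext_mulA : associative ext_mul.
Proof.
move=> [b a] [b' a'] [b'' a'']; rewrite /ext_mul /=; congr (_, _).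
  by rewrite addrA.
have fA := cocycleA f b b' b''.
rewrite -!addrA; congr (_ + (_ + _)).
by rewrite (addrCA (f b b')) (addrC (f b b')) fA (addrC (f b _)).
Qed.

Lemma ext_mulC x y : ext_mul x y = ext_mul y x.
Proof.
by rewrite /ext_mul (cocycleC f) (addrC x.1) (addrC x.2).
Qed.

Lemma ext_mul1 : left_id ext_one ext_mul.
Proof. by case=> b a; rewrite /ext_mul /= cocycle0x !add0r addr0. Qed.

Lemma ext_mulr1 : right_id ext_one ext_mul.
Proof. by move=> x; rewrite ext_mulC ext_mul1. Qed.

Lemma ext_mulrV : right_inverse ext_one ext_inv ext_mul.
Proof.
case=> b a; rewrite /ext_mul /=; congr (_, _); first by rewrite subrr.
by rewrite addrA subrr sub0r addNr.
Qed.

Lemma ext_mulV : left_inverse ext_one ext_inv ext_mul.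
Proof. by move=> x; rewrite ext_mulC ext_mulrV. Qed.

HB.instance Definition _ := isGroup.Build extension
  ext_mulA ext_mul1 ext_mulr1 ext_mulV ext_mulrV.

End Extension.

Definition group_isomorphic (G G' : groupType) : Prop :=
  exists phi : {multiplicative G -> G'}, bijective phi.

Definition is_extension (B A : zmodType) (f : sym_cocycle B A)
    (E : groupType) : Prop :=
  group_isomorphic E (extension_of f).

Definition ltpair (n : nat) : Type := {p : 'I_n * 'I_n | (p.1 < p.2)%N}.
HB.instance Definition _ (n : nat) := SubFinite.on (ltpair n).

(* the additive group of the direct sum of copies of R indexed by j < k *)
Definition pair_sum (R : comNzRingType) (n : nat) : zmodType :=
  {ffun ltpair n -> R}.

(* f is a phantom parameter, as in extension_of *)
Definition N2n (R : comNzRingType) (n : nat)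
    (f : 'I_n -> sym_cocycle R (pair_sum R n)) : Type :=
  ({ffun 'I_n -> R} * pair_sum R n)%type.

Section N2n.
Variables (R : comNzRingType) (n : nat).
Variable f : 'I_n -> sym_cocycle R (pair_sum R n).

Local Notation N := (N2n f).
HB.instance Definition _ := Choice.on N.

Definition N2n_mul (x y : N) : N :=
  ([ffun i => x.1 i + y.1 i],
   [ffun p : ltpair n => x.2 p + y.2 p + x.1 (val p).1 * y.1 (val p).2
                         + \sum_(k < n) f k (x.1 k) (y.1 k) p]).
Definition N2n_one : N := ([ffun=> 0], [ffun=> 0]).
Definition N2n_inv (x : N) : N :=
  ([ffun i => - x.1 i],
   [ffun p : ltpair n => - x.2 p + x.1 (val p).1 * x.1 (val p).2
                         - \sum_(k < n) f k (x.1 k) (- x.1 k) p]).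

Lemma N2n_mulA : associative N2n_mul.
Proof.
move=> [a c] [a' c'] [a'' c'']; rewrite /N2n_mul /=.
congr (_, _); apply/ffunP=> p; rewrite !ffunE; first by rewrite addrA.
have /(congr1 (fun s => \sum_(k < n) s k)) :
    (fun k => f k (a k + a' k) (a'' k) p + f k (a k) (a' k) p) =
    (fun k => f k (a k) (a' k + a'' k) p + f k (a' k) (a'' k) p).
  apply/funext=> k; have /(congr1 (fun g : {ffun ltpair n -> R} => g p)) :=
    cocycleA (f k) (a k) (a' k) (a'' k).
  by rewrite !ffunE.
rewrite !big_split /= => E.
rewrite mulrDr mulrDl.
have -> : \sum_(k < n) f k ([ffun i => a i + a' i] k) (a'' k) p =
          \sum_(k < n) f k (a k + a' k) (a'' k) p.
  by apply: eq_bigr => k _; rewrite ffunE.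
have -> : \sum_(k < n) f k (a k) ([ffun i => a' i + a'' i] k) p =
          \sum_(k < n) f k (a k) (a' k + a'' k) p.
  by apply: eq_bigr => k _; rewrite ffunE.
move: E; set S1 := \sum_(k < n) f k (_ + _) _ p.
set S2 := \sum_(k < n) f k (a k) (a' k) p.
set S3 := \sum_(k < n) f k _ (_ + _) p.
set S4 := \sum_(k < n) _ => E.
have -> : S1 = S3 + S4 - S2 by rewrite -E addrK.
ring.
Qed.

Lemma N2n_mul1 : left_id N2n_one N2n_mul.
Proof.
move=> [a c]; rewrite /N2n_mul /=; congr (_, _); apply/ffunP=> p;
  rewrite !ffunE ?add0r // mul0r addr0 big1 ?addr0 // => k _.
by rewrite ffunE cocycle0x ffunE.
Qed.

Lemma N2n_mulr1 : right_id N2n_one N2n_mul.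
Proof.
move=> [a c]; rewrite /N2n_mul /=; congr (_, _); apply/ffunP=> p;
  rewrite !ffunE ?addr0 // mulr0 addr0 big1 ?addr0 // => k _.
by rewrite ffunE cocyclex0 ffunE.
Qed.

Lemma N2n_mulV : left_inverse N2n_one N2n_inv N2n_mul.
Proof.
move=> [a c]; rewrite /N2n_mul /=; congr (_, _); apply/ffunP=> p;
  rewrite !ffunE ?addNr //.
under [X in _ + X]eq_bigr => k _ do rewrite ffunE cocycleC.
ring.
Qed.

Lemma N2n_mulrV : right_inverse N2n_one N2n_inv N2n_mul.
Proof.
move=> [a c]; rewrite /N2n_mul /=; congr (_, _); apply/ffunP=> p;
  rewrite !ffunE ?subrr //.
under [X in _ + X]eq_bigr => k _ do rewrite ffunE.
ring.
Qed.

HB.instance Definition _ := isGroup.Build N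
  N2n_mulA N2n_mul1 N2n_mulr1 N2n_mulV N2n_mulrV.

Definition std_basis (i : 'I_n) : N := ([ffun j => (j == i)%:R], [ffun=> 0]).

End N2n.

(* Main.v *)
Require Import Defs.
From HB Require Import structures.
From mathcomp Require Import all_boot all_algebra.
From mathcomp Require Import boolp classical_sets.
From mathcomp Require Import ring.

(** Write V = H / Z(H), H_i for the centraliser of h_i, and R = P(f_H).

    From a P(f_H)-basis to coordinates. By the decomposition of central
    elements along the H_ij, Z(H) is generated by commutators, so an element of
    P(f_H) is determined by its action on V, and moving two scalars past each
    other inside the nondegenerate form f_H shows that R is commutative; this
    makes R a commutative ring, nonzero because H is not trivial [PfH_ring].
    Cyclicity of H_i / Z(H) over R and the fact that H_i meets H_j in Z(H) show
    that r |-> r h_i is a bijection from R onto H_i / Z(H) [basis_free] and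
    that r |-> r [h_i, h_j] is a bijection from R onto H_ij [comm_coord_inj,
    comm_coordP]. As Z(H) is the direct product of the H_ij, this identifies
    Z(H) with the direct sum of copies of R [center_of]. Choose representatives
    t_i(r) in H_i of r h_i, with t_i(0) = 1 and t_i(1) = h_i, and let f^i
    measure their failure to be additive: t_i(r) t_i(s) = t_i(r + s) f^i(r, s).
    Associativity and commutativity in the abelian group H_i make f^i a
    symmetric 2-cocycle, and H_i is the extension that it defines
    [centraliser_extension]. As elements of H decompose along the H_i, uniquely
    modulo Z(H), the map (a, c) |-> t_n(a_n) ... t_1(a_1) c is a bijection onto
    H [from_coord_bij]. It is multiplicative [from_coordM]: merging two
    descending products moves t_j(b_j) to the left past t_i(a_i) for i < j, and
    each such move leaves the central commutator [t_i(a_i), t_j(b_j)] = a_i b_j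
    [h_i, h_j]; this is the term a_i b_j in the multiplication of N_{2,n},
    while the cocycle terms come from collecting t_i(a_i) t_i(b_i).

    From coordinates to a P(f_H)-basis. An isomorphism with N_{2,n} gives every
    x in H coordinates a in R^n and c in R^{i < j}. The cocycles are symmetric,
    so they cancel in commutators: [x, y] has coordinates a = 0 and c_ij = a_i
    b_j - b_i a_j [zcoordR]. All the subgroups in question are therefore cut
    out by the vanishing of coordinates, and the axioms can be read off
    [coord_is_basis]. The homotheties by elements of R belong to P(f_H) and
    carry h_i to any multiple [homothety_PfH]; conversely phi(h_i) commutes
    with h_i for every phi in P(f_H), since f_H(phi h_i, h_i) = phi f_H(h_i,
    h_i) = 1 [coord_is_PfH_basis]. *)

Set Implicit Arguments.
Unset Strict Implicit.
Unset Printing Implicit Defensive.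

Import GRing.Theory.
Local Open Scope group_scope.
Local Open Scope classical_set_scope.

(** * Homomorphisms and subgroups *)

Lemma morphg1 (G G' : groupType) (f : {multiplicative G -> G'}) : f 1 = 1.
Proof. by apply: (mulgI (f 1)); rewrite -gmulfM !mulg1. Qed.

Lemma morphgV (G G' : groupType) (f : {multiplicative G -> G'}) x :
  f x^-1 = (f x)^-1.
Proof. by apply/esym/mulg1_eq; rewrite -gmulfM mulgV morphg1. Qed.

Lemma morphg_prod (G G' : groupType) (f : {multiplicative G -> G'})
    I (r : seq I) (P : pred I) (F : I -> G) :
  f (\prod_(i <- r | P i) F i) = \prod_(i <- r | P i) f (F i).
Proof.
apply: (big_rec2 (fun x y => f x = y)) => [|i x y _ <-]; first exact: morphg1.
exact: gmulfM.
Qed.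

Definition hom_of (G G' : groupType) (f : G -> G')
    (fM : {morph f : x y / x * y}) : {multiplicative G -> G'} :=
  HB.pack f (isMultiplicative.Build G G' f fM).

Lemma bij_hom_inv (G G' : groupType) (f : {multiplicative G -> G'}) :
  bijective f -> exists g : {multiplicative G' -> G}, cancel f g /\ cancel g f.
Proof.
by case=> g fK gK; exists (hom_of (can2_gmulfM fK gK)).
Qed.

Lemma sum_homM (G G' : groupType) (f g : {multiplicative G -> G'}) :
  (forall a b : G', a * b = b * a) -> {morph (fun x => f x * g x) : x y / x * y}.
Proof.
move=> abG' x y; rewrite !gmulfM -!mulgA; congr (_ * _).
by rewrite !mulgA (abG' (f y)).
Qed.

Lemma opp_homM (G G' : groupType) (f : {multiplicative G -> G'}) :
  (forall a b : G', a * b = b * a) -> {morph (fun x => (f x)^-1) : x y / x * y}.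
Proof. by move=> abG' x y; rewrite gmulfM invgM abG'. Qed.

Definition sum_hom (G G' : groupType) abG' (f g : {multiplicative G -> G'}) :=
  hom_of (sum_homM f g abG').
Definition opp_hom (G G' : groupType) abG' (f : {multiplicative G -> G'}) :=
  hom_of (opp_homM f abG').

Definition one_hom (G G' : groupType) : {multiplicative G -> G'} :=
  hom_of (f := fun=> 1) (fun _ _ => esym (mulg1 1)).

Definition id_hom (G : groupType) : {multiplicative G -> G} :=
  hom_of (f := id) (fun _ _ => erefl).

Definition comp_hom (G G' G'' : groupType)
    (f : {multiplicative G' -> G''}) (g : {multiplicative G -> G'}) :=
  hom_of (comp_gmulfM f g).

Lemma eq_hom (G G' : groupType) (f g : {multiplicative G -> G'}) :
  f =1 g -> f = g.
Proof.
case: f g => [f [[fM]]] [g [[gM]]] /= /funext fg; move: fM gM.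
by rewrite -fg => fM gM; rewrite (Prop_irrelevance fM gM).
Qed.

Section Subgroups.
Variable H : groupType.
Implicit Types (K : subgroup H) (A B : set H) (x y z : H).

Lemma sg1 K : sgset K 1.
Proof. by have /is_subgroupP[] := sgsetP K. Qed.

Lemma sgV K x : sgset K x -> sgset K x^-1.
Proof.
by have /is_subgroupP[K1 KV] := sgsetP K => /(KV _ _ K1); rewrite mul1g.
Qed.

Lemma sgM K x y : sgset K x -> sgset K y -> sgset K (x * y).
Proof.
have /is_subgroupP[_ KV] := sgsetP K => Kx Ky.
by rewrite -[y]invgK; apply/KV/sgV.
Qed.

Lemma sg_prod K I (r : seq I) (P : pred I) (F : I -> H) :
  (forall i, P i -> sgset K (F i)) -> sgset K (\prod_(i <- r | P i) F i).
Proof. by apply: big_ind; [exact: sg1 | exact: sgM]. Qed.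

Lemma val_sg1 K : val (1 : sgtype K) = 1.
Proof. exact: gmulf1. Qed.

Lemma val_sgM K (a b : sgtype K) : val (a * b) = val a * val b.
Proof. exact: gmulfM. Qed.

Lemma val_sgV K (a : sgtype K) : val a^-1 = (val a)^-1.
Proof. exact: gmulfV. Qed.

Lemma commg_sg_mem A B x y : A x -> B y -> sgset (commg_sg A B) [~ x, y].
Proof. by move=> Ax By C [_]; apply; exists x, y. Qed.

Lemma commg_sg_sub A B K :
  (forall x y, A x -> B y -> sgset K [~ x, y]) -> commg_sg A B `<=` K.
Proof.
move=> sub z; apply; split; first exact: sgsetP.
by move=> _ [x [y [Ax By ->]]]; apply: sub.
Qed.

Lemma center_commute x z : sgset (center H) z -> commute x z.
Proof. exact. Qed.

Lemma val_center (z : sgtype (center H)) : sgset (center H) (val z).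
Proof. exact/set_mem/valP. Qed.

Definition to_center x : sgtype (center H) := insubd 1 x.

Lemma to_centerK x : sgset (center H) x -> val (to_center x) = x.
Proof. by move=> Zx; apply/insubdK/mem_set. Qed.

Lemma centerC (z t : sgtype (center H)) : z * t = t * z.
Proof. by apply/val_inj; rewrite !val_sgM; apply: val_center. Qed.

Lemma cosetZ1 z : sgset (center H) z <-> cosetZ z = 1.
Proof.
split=> [Zz|/esym/cosetZ_eq]; last by rewrite invg1 mul1g.
by apply/esym/cosetZ_eq; rewrite invg1 mul1g.
Qed.

Lemma cosetZ_mod x y : cosetZ x = cosetZ y ->
  exists2 z, sgset (center H) z & y = x * z.
Proof. by move=> /cosetZ_eq Zxy; exists (x^-1 * y); rewrite ?mulVKg. Qed.

End Subgroups.

(** * Groups of nilpotency class two *)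

Section ClassTwo.
Variable H : groupType.
Hypothesis class2 : forall x y : H, sgset (center H) [~ x, y].
Implicit Types (x y z : H) (u v w : quoZ H).

Lemma commMgl x y z : [~ x * y, z] = [~ x, z] * [~ y, z].
Proof.
have -> : [~ x * y, z] = y^-1 * [~ x, z] * (z^-1 * (y * z)).
  by rewrite !commgEl !conjgE !invgM -!mulgA mulVKg.
by rewrite (class2 x z) -mulgA.
Qed.

Lemma commMgr x y z : [~ x, y * z] = [~ x, y] * [~ x, z].
Proof.
by rewrite -invgR commMgl invgM !invgR; apply: class2.
Qed.

Lemma commg_prodl I (r : seq I) (P : pred I) (F : I -> H) y :
  [~ \prod_(i <- r | P i) F i, y] = \prod_(i <- r | P i) [~ F i, y].
Proof.
by apply: (big_morph (fun x => [~ x, y])) => [x x'|];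
  [exact: commMgl | exact: comm1g].
Qed.

(** The collection process: bringing y_j to its place means moving it to the
    left past all x_i with i < j, and in class two each such move costs exactly
    the central factor [x_i, y_j].  The order of the commutators is the one
    that the induction on the largest index produces. *)
Lemma prod_descendingM n (x y : 'I_n -> H) :
  (\prod_(i < n) x (rev_ord i)) * (\prod_(i < n) y (rev_ord i)) =
  (\prod_(i < n) (x (rev_ord i) * y (rev_ord i))) *
  \prod_(i < n) \prod_(j < n | (rev_ord i < j)%N) [~ x (rev_ord i), y j].
Proof.
elim: n x y => [|n IHn] x y; first by rewrite !big_ord0 !mulg1.
(* Both descending products start with their factor of index ord_max. *)
rewrite !big_ord_recl; pose w := widen_ord (leqnSn n).
have -> : rev_ord ord0 = ord_max :> 'I_n.+1.
  by apply/val_inj; rewrite /= subSS subn0.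
have revE (i : 'I_n) : rev_ord (lift ord0 i) = w (rev_ord i).
  by apply/val_inj; rewrite /= /bump /= add1n subSS.
under eq_bigr do rewrite revE.
under [\prod_(i < n) y _]eq_bigr do rewrite revE.
under [\prod_(i < n) (_ * _)]eq_bigr do rewrite revE.
under [\prod_(i < n) \prod_(j < _ | _) _]eq_bigr => i _.
  rewrite revE big_mkcond big_ord_recr (ltn_ord (rev_ord i)) -big_mkcond; over.
rewrite [X in _ = _ * (X * _)]big1; last first.
  by move=> j; rewrite ltnNge leq_ord.
rewrite mul1g [X in _ = _ * X]prodgM_commute; last first.
  move=> i j _ _; exact: (center_commute _ (class2 _ _)).
rewrite -commg_prodl; have := IHn (x \o w) (y \o w).
rewrite /=; set X := \prod_(i < n) x _; set Y := \prod_(i < n) y _ => XY.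
have := class2 X (y ord_max); have := commgC X (y ord_max).
move: [~ X, _] => c Xy Zc; rewrite -!mulgA (mulgA _ _ c) -XY.
congr (_ * _); rewrite (mulgA X) Xy -!mulgA; congr (_ * (_ * _)).
exact/esym/Zc.
Qed.

Lemma quoZC u v : u * v = v * u.
Proof.
have [[x ->] [y ->]] := (cosetZ_surj u, cosetZ_surj v).
by rewrite -!cosetZM (commgC x) cosetZ_mulr.
Qed.

Lemma fH_coset x y : val (fH (cosetZ x) (cosetZ y)) = [~ x, y].
Proof. exact: fHE. Qed.

Lemma fHMl u v w : fH (u * v) w = fH u w * fH v w.
Proof.
have [[[x ->] [y ->]] [z ->]] := (cosetZ_surj u, cosetZ_surj v, cosetZ_surj w).
by apply/val_inj; rewrite val_sgM -cosetZM !fH_coset commMgl.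
Qed.

Lemma fHMr u v w : fH u (v * w) = fH u v * fH u w.
Proof.
have [[[x ->] [y ->]] [z ->]] := (cosetZ_surj u, cosetZ_surj v, cosetZ_surj w).
by apply/val_inj; rewrite val_sgM -cosetZM !fH_coset commMgr.
Qed.

Lemma fH1l w : fH 1 w = 1.
Proof. exact: (morphg1 (hom_of (fun u v => fHMl u v w))). Qed.

Lemma fH1r u : fH u 1 = 1.
Proof. exact: (morphg1 (hom_of (fHMr u))). Qed.

Lemma fHVl u w : fH u^-1 w = (fH u w)^-1.
Proof. exact: (morphgV (hom_of (fun u v => fHMl u v w))). Qed.

Lemma fHVr u w : fH u w^-1 = (fH u w)^-1.
Proof. exact: (morphgV (hom_of (fHMr u))). Qed.

Lemma fH_nondegenerate u : (forall w, fH u w = 1) -> u = 1.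
Proof.
have [x ->] := cosetZ_surj u => fx1; apply/cosetZ1 => y.
by apply/esym/commgP/eqP; rewrite -fH_coset fx1 val_sg1.
Qed.

End ClassTwo.

(** * The ring P(f_H) *)

Section ScalarRing.
Variable H : groupType.
Hypothesis Zcomm : commg_sg setT setT = center H :> set H.
Hypothesis ntH : exists x : H, x <> 1.

Let class2 (x y : H) : sgset (center H) [~ x, y].
Proof. by rewrite -Zcomm; apply: commg_sg_mem. Qed.

(** Since Z(H) = [H, H], the values of f_H generate the centre. *)
Lemma center_ind (P : sgtype (center H) -> Prop) :
    P 1 -> (forall a b, P a -> P b -> P (a / b)) ->
    (forall u w, P (fH u w)) -> forall z, P z.
Proof.
move=> P1 PV Pf z.
have KP : is_subgroup [set x | sgset (center H) x /\ P (to_center x)].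
  apply/is_subgroupP; split=> [|x y [Zx Px] [Zy Py]].
    split; first exact: sg1.
    by rewrite [to_center 1](_ : _ = 1) //; apply/val_inj; rewrite to_centerK;
      [rewrite val_sg1 | exact: sg1].
  have Zxy : sgset (center H) (x / y) by apply/sgM/sgV.
  split=> //; rewrite [to_center _](_ : _ = to_center x / to_center y).
    exact: PV.
  by apply/val_inj; rewrite val_sgM val_sgV !to_centerK.
have zC : sgset (commg_sg setT setT) (val z).
  by move: (val z) (val_center z) => x; rewrite -Zcomm.
case: (@commg_sg_sub H setT setT (Subgroup KP) _ _ zC).
  move=> x y _ _; split; first exact: class2.
  rewrite [to_center _](_ : _ = fH (cosetZ x) (cosetZ y)) //.
  by apply/val_inj; rewrite to_centerK // fH_coset.
move=> _; rewrite [to_center _](_ : _ = z) //.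
by apply/val_inj; rewrite to_centerK //; apply: val_center.
Qed.

(** The two hypotheses are arguments of the carrier because the ring structure
    depends on them: Z(H) = [H, H] for commutativity, H <> 1 for 1 <> 0. *)
Definition PfH_ring of commg_sg setT setT = center H :> set H
  & (exists x : H, x <> 1) : Type := {phi | @PfH H phi}.
Local Notation R := (PfH_ring Zcomm ntH).

HB.instance Definition _ := gen_eqMixin R.
HB.instance Definition _ := gen_choiceMixin R.

Definition actV (r : R) : {multiplicative quoZ H -> quoZ H} := (sval r).1.
Definition actZ (r : R) :
  {multiplicative sgtype (center H) -> sgtype (center H)} := (sval r).2.

Lemma fH_actr (r : R) u w : fH u (actV r w) = actZ r (fH u w).
Proof. by have [] := svalP r u w. Qed.

Lemma fH_actl (r : R) u w : fH (actV r u) w = actZ r (fH u w).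
Proof. by rewrite -fH_actr; have [] := svalP r u w. Qed.

(** The component on Z(H) is forced by the one on H / Z(H), as Z(H) is
    generated by the values of f_H.  So the ring laws need only be checked on
    H / Z(H). *)
Lemma eq_PfH_ring (r s : R) : actV r =1 actV s -> r = s.
Proof.
move=> rs; have rs0 : actZ r =1 actZ s.
  apply: center_ind => [|a b ea eb|u w]; rewrite ?morphg1 //.
    by rewrite !gmulfM !morphgV ea eb.
  by rewrite -!fH_actr rs.
apply: eq_sig_hprop => [phi|]; first exact: Prop_irrelevance.
by rewrite [LHS]surjective_pairing [RHS]surjective_pairing; congr (_, _);
  apply: eq_hom.
Qed.

Let VC := quoZC class2.
Let ZC := @centerC H.

Lemma scalar0_subproof : @PfH H (one_hom _ _, one_hom _ _).
Proof. by move=> u w /=; rewrite fH1l // fH1r. Qed.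

Lemma scalarD_subproof (r s : R) :
  @PfH H (sum_hom VC (actV r) (actV s), sum_hom ZC (actZ r) (actZ s)).
Proof. by move=> u w /=; rewrite fHMl ?fHMr ?fH_actl ?fH_actr. Qed.

Lemma scalarN_subproof (r : R) :
  @PfH H (opp_hom VC (actV r), opp_hom ZC (actZ r)).
Proof. by move=> u w /=; rewrite fHVl ?fHVr ?fH_actl ?fH_actr. Qed.

Lemma scalar1_subproof : @PfH H (id_hom _, id_hom _).
Proof. by []. Qed.

Lemma scalarM_subproof (r s : R) :
  @PfH H (comp_hom (actV r) (actV s), comp_hom (actZ r) (actZ s)).
Proof. by move=> u w /=; rewrite !fH_actl !fH_actr. Qed.

Definition scalar0 : R := exist _ _ scalar0_subproof.
Definition scalar1 : R := exist _ _ scalar1_subproof.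
Definition scalarD (r s : R) : R := exist _ _ (scalarD_subproof r s).
Definition scalarN (r : R) : R := exist _ _ (scalarN_subproof r).
Definition scalarM (r s : R) : R := exist _ _ (scalarM_subproof r s).

Lemma scalarDA : associative scalarD.
Proof. by move=> r s t; apply: eq_PfH_ring => u; apply: mulgA. Qed.

Lemma scalarDC : commutative scalarD.
Proof. by move=> r s; apply: eq_PfH_ring => u; apply: VC. Qed.

Lemma scalar0D : left_id scalar0 scalarD.
Proof. by move=> r; apply: eq_PfH_ring => u; apply: mul1g. Qed.

Lemma scalarND : left_inverse scalar0 scalarN scalarD.
Proof. by move=> r; apply: eq_PfH_ring => u; apply: mulVg. Qed.

HB.instance Definition _ :=
  GRing.isZmodule.Build R scalarDA scalarDC scalar0D scalarND.

Lemma scalarMA : associative scalarM.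
Proof. by move=> r s t; apply: eq_PfH_ring. Qed.

(** Both r s u and s r u pair with w to r s f_H(u, w): move r to the second
    argument, take s out, and bring r back out.  Nondegeneracy concludes. *)
Lemma scalarMC : commutative scalarM.
Proof.
move=> r s; apply: eq_PfH_ring => u /=; apply/divg1_eq.
apply: fH_nondegenerate => // w; rewrite fHMl // fHVl // !fH_actl.
have -> : actZ r (actZ s (fH u w)) = actZ s (actZ r (fH u w)).
  by rewrite -(fH_actl s) -(fH_actr r) fH_actl fH_actr.
exact: mulgV.
Qed.

Lemma scalar1M : left_id scalar1 scalarM.
Proof. by move=> r; apply: eq_PfH_ring. Qed.

Lemma scalarMDl : left_distributive scalarM scalarD.
Proof. by move=> r s t; apply: eq_PfH_ring. Qed.

(** If 1 = 0 then H / Z(H) is trivial, so H is abelian, and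
    H = Z(H) = [H, H] = 1. *)
Lemma scalar1_neq0 : scalar1 != scalar0.
Proof.
apply/eqP => e10; have [x] := ntH; apply.
have V1 (u : quoZ H) : u = 1 by have := congr1 (fun r => actV r u) e10.
have Zx : sgset (center H) x by apply/cosetZ1/V1.
rewrite -(to_centerK Zx) -[RHS](val_sg1 (center H)); congr val.
apply: (center_ind (P := fun z => z = 1)) => // [a b -> ->|u w].
  exact: divgg.
by rewrite (V1 u) fH1l.
Qed.

HB.instance Definition _ := GRing.Zmodule_isComNzRing.Build R
  scalarMA scalarMC scalar1M scalarMDl scalar1_neq0.

Lemma actVD (r s : R) u : actV (r + s)%R u = actV r u * actV s u.
Proof. by []. Qed.

Lemma actVN (r : R) u : actV (- r)%R u = (actV r u)^-1.
Proof. by []. Qed.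

Lemma actVM (r s : R) u : actV (r * s)%R u = actV r (actV s u).
Proof. by []. Qed.

Lemma actZD (r s : R) z : actZ (r + s)%R z = actZ r z * actZ s z.
Proof. by []. Qed.

Lemma actZM (r s : R) z : actZ (r * s)%R z = actZ r (actZ s z).
Proof. by []. Qed.

End ScalarRing.

(** * Consequences of the basis axioms *)

Lemma inj_surj_bijective T U (f : T -> U) :
  injective f -> (forall y, exists x, f x = y) -> bijective f.
Proof.
move=> fI /choice[g fK]; exists g => // x; apply: fI; exact: fK.
Qed.

Lemma eq_subgroup (H : groupType) (A B : subgroup H) :
  A = B :> set H -> A = B.
Proof.
case: A B => [A AP] [B BP] /= AB; move: AP BP; rewrite AB => AP BP.
by rewrite (Prop_irrelevance AP BP).
Qed.

Section BasisFacts.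
Variables (H : groupType) (n : nat) (h : 'I_n -> H).
Hypothesis hb : is_basis h.
Local Notation C i := (sgset (centraliser (h i))).
Local Notation Z := (sgset (center H)).
Local Notation prod_desc u := (\prod_(i < n) u (rev_ord i)).
Local Notation prod_pairs u :=
  (\prod_(i < n) \prod_(j < n | (i < j)%N) u i j).

(** The H_i can be eliminated in favour of the centralisers; the H_ij stay
    quantified, since only those with i < j are determined. *)
Lemma basis_forC :
  exists Hij, is_basis_for h (fun i => centraliser (h i)) Hij.
Proof.
have [_ _ [Hi [Hij hbas]]] := hb; exists Hij.
have [[HiC _] _ _ _ _] := hbas.
suff <- : Hi = fun i => centraliser (h i) by [].
by apply/funext => i; apply/eq_subgroup/HiC.
Qed.

Lemma basis_capZ i j x : i != j -> C i x -> C j x -> Z x.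
Proof.
have [Hij [_ HiI _ _ _]] := basis_forC.
rewrite neq_ltn => /orP[] ij Cix Cjx.
  by rewrite -(HiI i j ij).
by rewrite -(HiI j i ij).
Qed.

Lemma basis_abelian i x y : C i x -> C i y -> commute x y.
Proof.
have [Hij [_ _ Hab _ _]] := basis_forC => Cx Cy; apply/commgP/eqP.
by have := commg_sg_mem Cx Cy; rewrite (Hab i).
Qed.

Lemma basis_class2 (x y : H) : Z [~ x, y].
Proof.
have [Hij [_ _ _ HZ _]] := basis_forC.
by apply: (HZ _); apply: commg_sg_mem.
Qed.

Lemma basis_dec x :
  exists u v, [/\ forall i, C i (u i), Z v & x = prod_desc u * v].
Proof.
have [Hij [_ _ _ _ [ex5a _ _ _]]] := basis_forC.
by have [u [v [uC Zv xE]]] := ex5a x; exists u, v.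
Qed.

Lemma basis_dec_uniq u v u' v' :
    (forall i, C i (u i)) -> (forall i, C i (u' i)) -> Z v -> Z v' ->
  prod_desc u * v = prod_desc u' * v' -> forall i, cosetZ (u i) = cosetZ (u' i).
Proof.
have [Hij [_ _ _ _ [_ un5a _ _]]] := basis_forC.
by move=> Cu Cu' Zv Zv' e; apply: (un5a (prod_desc u * v) u v u' v').
Qed.

Lemma basis_cdec v : Z v -> exists u : 'I_n -> 'I_n -> H,
  (forall i j : 'I_n, (i < j)%N -> sgset (commg_sg [set h i] (C j)) (u i j)) /\
  v = prod_pairs u.
Proof.
have [Hij [[_ HijE] _ _ _ [_ _ ex5b _]]] := basis_forC.
move=> /ex5b[u [uP ->]]; exists u; split=> // i j ij.
by have [<- _ _] := HijE i j ij; apply: uP.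
Qed.

Lemma basis_cdec_uniq (u u' : 'I_n -> 'I_n -> H) :
    (forall i j : 'I_n, (i < j)%N -> sgset (commg_sg [set h i] (C j)) (u i j)) ->
    (forall i j : 'I_n, (i < j)%N -> sgset (commg_sg [set h i] (C j)) (u' i j)) ->
    prod_pairs u = prod_pairs u' ->
  forall i j : 'I_n, (i < j)%N -> u i j = u' i j.
Proof.
have [Hij [[_ HijE] _ _ _ [_ _ _ un5b]]] := basis_forC.
move=> uP u'P e.
have HijP (w : 'I_n -> 'I_n -> H) : (forall i j : 'I_n, (i < j)%N ->
    sgset (commg_sg [set h i] (C j)) (w i j)) ->
    forall i j : 'I_n, (i < j)%N -> sgset (Hij i j) (w i j).
  by move=> wP i j ij; have [-> _ _] := HijE i j ij; apply: wP.
have Zu : Z (prod_pairs u).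
  apply: sg_prod => i _; apply: sg_prod => j ij.
  have := uP i j ij; move: (u i j); apply: commg_sg_sub => x y _ _.
  exact: basis_class2.
by apply: (un5b _ _ _ Zu); split=> //; apply: HijP.
Qed.

Lemma centerS_centraliser i x : Z x -> C i x.
Proof. by move=> Zx; apply: Zx. Qed.

(** A central element is a product of elements of the H_ij, and these subgroups
    are generated by commutators. *)
Lemma basis_center_comm : commg_sg setT setT = center H :> set H.
Proof.
apply/seteqP; split=> [|v /basis_cdec[u [uP ->]]].
  by apply: commg_sg_sub => x y _ _; apply: basis_class2.
apply: sg_prod => i _; apply: sg_prod => j ij.
have := uP i j ij; move: (u i j); apply: commg_sg_sub => x y _ _.
exact: commg_sg_mem.
Qed.

Lemma basis_nontrivial (i0 : 'I_n) : exists x : H, x <> 1.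
Proof. by have [_ h1 _] := hb; exists (h i0). Qed.

End BasisFacts.

(** * Coordinates on a group with a P(f_H)-basis *)

Section Construction.
Variables (H : groupType) (n : nat) (h : 'I_n -> H).
Hypothesis hb : is_PfH_basis h.
Hypothesis ntH : exists x : H, x <> 1.
Local Notation C i := (sgset (centraliser (h i))).
Local Notation Z := (sgset (center H)).
Let bas : is_basis h := proj1 hb.
Let class2 := basis_class2 bas.
Local Notation R := (PfH_ring (basis_center_comm bas) ntH).
Local Notation e i := (cosetZ (h i)).

Lemma centraliser_scalar i x : C i x <-> exists r : R, cosetZ x = actV r (e i).
Proof.
have hcyc := hb.2 i; split=> [Cx|[r xE]].
  have : [set cosetZ x | x in C i] (cosetZ x) by exists x.
  rewrite hcyc => -[phi phiP phiE].
  by exists (exist _ phi phiP : R); rewrite -phiE.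
have : [set phi.1 (e i) | phi in @PfH H] (cosetZ x).
  by exists (sval r); [exact: svalP | rewrite xE].
rewrite -hcyc => -[y Cy /cosetZ_mod[z Zz ->]].
by apply: sgM Cy _; apply: centerS_centraliser Zz.
Qed.

(** The element r [h_i, h_j] of H_ij. *)
Definition comm_coord (i j : 'I_n) (r : R) : H := val (actZ r (fH (e i) (e j))).

Lemma comm_coordE i j (r s : R) x y :
  cosetZ x = actV r (e i) -> cosetZ y = actV s (e j) ->
  [~ x, y] = comm_coord i j (r * s)%R.
Proof.
move=> xE yE; rewrite -fH_coset // xE yE fH_actl fH_actr.
by rewrite -actZM.
Qed.

Lemma comm_coordD i j (r s : R) :
  comm_coord i j (r + s)%R = comm_coord i j r * comm_coord i j s.
Proof. by rewrite /comm_coord actZD val_sgM. Qed.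

Lemma actV0 u : actV (0%R : R) u = 1.
Proof. by []. Qed.

(** If r [h_i, h_j] = 1 then r h_j commutes with h_i, hence lies in
    H_i and H_j at once, and this intersection is the centre. *)
Lemma comm_coord_ker i j (r : R) :
  i != j -> comm_coord i j r = 1 -> actV r (e j) = 1.
Proof.
move=> ij r1.
have yE : cosetZ (repr (actV r (e j))) = actV r (e j) by rewrite cosetZ_repr.
rewrite -yE; apply/cosetZ1; apply: (basis_capZ bas ij); last first.
  by apply/centraliser_scalar; exists r.
by apply/commgP/eqP; rewrite (@comm_coordE i j 1%R r) // mul1r.
Qed.

(** A scalar that kills one basis vector kills all of H / Z(H): it kills every
    other h_j since r [h_i, h_j] = [r h_i, h_j], and then every multiple s h_j
    because the ring is commutative. *)
Lemma basis_free i (r : R) : actV r (e i) = 1 -> r = 0%R.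
Proof.
move=> ri1; have rj1 j : actV r (e j) = 1.
  have [<-//|ij] := eqVneq i j; apply: (comm_coord_ker ij).
  by rewrite /comm_coord -fH_actl ri1 fH1l // val_sg1.
apply: eq_PfH_ring => u; rewrite actV0.
have [x ->] := cosetZ_surj u; have [w [v [Cw Zv ->]]] := basis_dec bas x.
have rM : {morph (fun x => actV r (cosetZ x)) : x y / x * y}.
  by move=> a b; rewrite cosetZM gmulfM.
rewrite cosetZ_mulr // -[LHS]/(hom_of rM _) morphg_prod big1 //= => i' _.
have [s ->] := (centraliser_scalar _ _).1 (Cw (rev_ord i')).
by rewrite -actVM mulrC actVM rj1 morphg1.
Qed.

Lemma basis_act_inj i : injective (fun r : R => actV r (e i)).
Proof.
move=> r s rs; apply/subr0_eq/(@basis_free i).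
by rewrite actVD actVN rs mulgV.
Qed.

Lemma comm_coord_inj i j : i != j -> injective (comm_coord i j).
Proof.
move=> ij r s rs; apply/subr0_eq/(@basis_free j)/(comm_coord_ker ij).
by apply: (mulIg (comm_coord i j s)); rewrite -comm_coordD subrK rs mul1g.
Qed.

Lemma comm_coord0 i j : comm_coord i j 0%R = 1.
Proof. by rewrite /comm_coord; rewrite -[RHS](val_sg1 (center H)). Qed.

(** The elements r [h_i, h_j] already form a group, so H_ij, generated by the
    [h_i, y] with y in H_j, contains nothing else. *)
Lemma comm_coordP i j x :
  sgset (commg_sg [set h i] (C j)) x <-> exists r, x = comm_coord i j r.
Proof.
split=> [|[r ->]]; last first.
  have yE : cosetZ (repr (actV r (e j))) = actV r (e j) by rewrite cosetZ_repr.
  rewrite -(mul1r r) -(@comm_coordE i j 1%R r _ _ (erefl _) yE).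
  by apply: commg_sg_mem => //; apply/centraliser_scalar; exists r.
have KP : is_subgroup [set x | exists r, x = comm_coord i j r].
  apply/is_subgroupP; split=> [|_ _ [r ->] [s ->]].
    by exists 0%R; rewrite comm_coord0.
  by exists (r - s)%R.
move=> xC; apply: (@commg_sg_sub H _ _ (Subgroup KP) _ x xC) => _ y -> /=.
by move=> /centraliser_scalar[r yE]; exists (1 * r)%R; apply: comm_coordE.
Qed.

Local Notation P := (pair_sum R n).

(** Coefficients extended by zero to all pairs of indices, because the products
    that decompose central elements run over i and then over j > i. *)
Definition pair_coef (c : P) (i j : 'I_n) : R :=
  if insub (i, j) is Some p then c p else 0%R.

Lemma pair_coef_val (c : P) (p : ltpair n) :
  pair_coef c (val p).1 (val p).2 = c p.
Proof. by rewrite /pair_coef -surjective_pairing valK. Qed.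

Lemma pair_coefD (c d : P) i j :
  pair_coef (c + d)%R i j = (pair_coef c i j + pair_coef d i j)%R.
Proof.
by rewrite /pair_coef; case: insub => [p|]; rewrite ?ffunE ?addr0.
Qed.

(** The isomorphism from the direct sum of copies of R onto Z(H) that sends
    (c_ij) to the product of the elements c_ij [h_i, h_j]. *)
Definition center_of (c : P) : H :=
  \prod_(i < n) \prod_(j < n | (i < j)%N) comm_coord i j (pair_coef c i j).

Lemma comm_coordZ i j r : Z (comm_coord i j r).
Proof. exact: val_center. Qed.

Lemma center_ofZ c : Z (center_of c).
Proof. by do 2![apply: sg_prod => ? _]; apply: comm_coordZ. Qed.

Lemma center_ofD c d : center_of (c + d)%R = center_of c * center_of d.
Proof.
rewrite /center_of -prodgM_commute => [|i j _ _]; last first.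
  by apply: (center_commute _); apply: sg_prod => ? _; apply: comm_coordZ.
apply: eq_bigr => i _; rewrite -prodgM_commute => [|j k _ _]; last first.
  by exact: (center_commute _ (comm_coordZ _ _ _)).
by apply: eq_bigr => j _; rewrite pair_coefD comm_coordD.
Qed.

Lemma center_of0 : center_of 0%R = 1.
Proof. by apply: (mulgI (center_of 0%R)); rewrite -center_ofD addr0 mulg1. Qed.

Lemma center_of_inj : injective center_of.
Proof.
move=> c d cd; apply/ffunP => p; rewrite -!pair_coef_val.
have ij := valP p; apply: (@comm_coord_inj (val p).1 (val p).2).
  by rewrite neq_ltn ij.
apply: (basis_cdec_uniq bas _ _ cd ij) => i j _;
  by apply/comm_coordP; eexists.
Qed.

Lemma center_of_surj x : Z x -> exists c, center_of c = x.
Proof.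
case/(basis_cdec bas) => u [uP ->].
have /choice[r rP] : forall p : ltpair n, exists r,
    u (val p).1 (val p).2 = comm_coord (val p).1 (val p).2 r.
  by move=> p; apply/comm_coordP; apply: uP; apply: (valP p).
exists [ffun p => r p]; apply: eq_bigr => i _; apply: eq_bigr => j ij.
pose p : ltpair n := Sub (i, j) ij.
rewrite -[i]/(val p).1 -[j]/(val p).2.
by rewrite pair_coef_val ffunE rP.
Qed.

Definition pair_single (i j : 'I_n) (r : R) : P :=
  [ffun p => if val p == (i, j) then r else 0%R].

Lemma center_of_single (i j : 'I_n) r : (i < j)%N ->
  center_of (pair_single i j r) = comm_coord i j r.
Proof.
move=> ij; have coefE (i' j' : 'I_n) : pair_coef (pair_single i j r) i' j' =
    if (i' == i) && (j' == j) then r else 0%R.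
  rewrite /pair_coef; case: insubP => [p _ pE|/=].
    by rewrite ffunE pE xpair_eqE.
  by case: eqVneq => [->|//]; case: eqVneq => [->|//]; rewrite ij.
rewrite /center_of (big_only1 i) // => [|i' ii' _]; last first.
  by apply: big1 => j' _; rewrite coefE (negPf ii') comm_coord0.
rewrite (big_only1 j) // ?coefE ?eqxx // => j' jj' _.
by rewrite coefE (negPf jj') andbF comm_coord0.
Qed.

(** Representatives in H_i of the elements r h_i of H_i / Z(H); the values at
    0 and 1 are prescribed so that the cocycle is normalised and the standard
    basis is sent to h. *)
Definition transversal (i : 'I_n) (r : R) : H :=
  if r == 0%R then 1 else if r == 1%R then h i else repr (actV r (e i)).

Lemma cosetZ_transversal i r : cosetZ (transversal i r) = actV r (e i).
Proof.
rewrite /transversal; case: eqP => [->|_]; first by apply/cosetZ1/sg1.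
by case: eqP => [->|_] //; rewrite cosetZ_repr.
Qed.

Lemma transversal0 i : transversal i 0%R = 1.
Proof. by rewrite /transversal eqxx. Qed.

Lemma transversal1 i : transversal i 1%R = h i.
Proof. by rewrite /transversal oner_eq0 eqxx. Qed.

Lemma transversalC i r : C i (transversal i r).
Proof. by apply/centraliser_scalar; exists r; apply: cosetZ_transversal. Qed.

Lemma transversal_center i x r : cosetZ x = actV r (e i) ->
  exists c, x = transversal i r * center_of c.
Proof.
rewrite -cosetZ_transversal => /esym/cosetZ_mod[z /center_of_surj[c <-] ->].
by exists c.
Qed.

Lemma defect_subproof i r s : exists c,
  transversal i r * transversal i s = transversal i (r + s)%R * center_of c.
Proof.
by apply: transversal_center; rewrite cosetZM !cosetZ_transversal actVD.
Qed.

(** The cocycle f^i: how far the transversal of H_i / Z(H) is from being a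
    homomorphism. *)
Definition defect i r s : P := projT1 (cid (defect_subproof i r s)).

Lemma defectE i r s : transversal i r * transversal i s =
  transversal i (r + s)%R * center_of (defect i r s).
Proof. by rewrite /defect; case: cid. Qed.

Lemma transversalZ_inj i r c d :
  transversal i r * center_of c = transversal i r * center_of d -> c = d.
Proof. by move=> /mulgI/center_of_inj. Qed.

Lemma defect0x i r : defect i 0%R r = 0%R.
Proof.
apply: (@transversalZ_inj i (0 + r)%R); rewrite -defectE transversal0 mul1g.
by rewrite add0r center_of0 mulg1.
Qed.

Lemma defectC i r s : defect i r s = defect i s r.
Proof.
apply: (@transversalZ_inj i (r + s)%R); rewrite -defectE addrC -defectE.
by apply: (basis_abelian bas); apply: transversalC.
Qed.

Lemma defectx0 i r : defect i r 0%R = 0%R.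
Proof. by rewrite defectC defect0x. Qed.

(** Both sides compare t_i(r) t_i(s) t_i(t) with t_i(r + s + t), for the two
    ways of bracketing the product. *)
Lemma defectA i r s t : (defect i (r + s) t + defect i r s =
  defect i r (s + t) + defect i s t)%R.
Proof.
apply: (@transversalZ_inj i (r + s + t)%R).
transitivity (transversal i r * transversal i s * transversal i t).
  rewrite (defectE i r s) -mulgA -(center_ofZ _ (transversal i t)) mulgA.
  by rewrite defectE -mulgA -center_ofD.
by rewrite -mulgA defectE mulgA defectE -mulgA -center_ofD addrA.
Qed.

Definition defect_cocycle i : sym_cocycle R P :=
  SymCocycle (defect0x i) (defectx0 i) (defectA i) (defectC i).

Lemma center_of_sum I (r : seq I) (Q : pred I) (F : I -> P) :
  center_of (\sum_(i <- r | Q i) F i)%R = \prod_(i <- r | Q i) center_of (F i).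
Proof. exact: (big_morph _ center_ofD center_of0). Qed.

(** The commutators left over by the collection process add up to the bilinear
    term a_i b_j in the multiplication of N_{2,n}. *)
Lemma prod_transversal_comm (a b : 'I_n -> R) :
  \prod_(i < n) \prod_(j < n | (rev_ord i < j)%N)
    [~ transversal (rev_ord i) (a (rev_ord i)), transversal j (b j)] =
  center_of [ffun p : ltpair n => a (val p).1 * b (val p).2]%R.
Proof.
pose S (i : 'I_n) := (\sum_(j < n | (i < j)%N) pair_single i j (a i * b j))%R.
transitivity (center_of (\sum_(i < n) S i)%R).
  rewrite (reindex_inj rev_ord_inj) center_of_sum; apply: eq_bigr => i _.
  rewrite center_of_sum; apply: eq_bigr => j ij.
  by rewrite center_of_single //; apply: comm_coordE; apply: cosetZ_transversal.
congr center_of; apply/ffunP => p; rewrite ffunE sum_ffunE.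
rewrite (big_only1 (val p).1) // => [|i ip _]; rewrite sum_ffunE.
  rewrite (big_only1 (val p).2) ?(valP p) // => [|j jp _]; rewrite ffunE.
    by rewrite -surjective_pairing eqxx.
  by case: eqP => // pE; rewrite pE eqxx in jp.
by apply: big1 => j _; rewrite ffunE; case: eqP => // pE; rewrite pE eqxx in ip.
Qed.

Lemma prod_transversalM (a b : 'I_n -> R) :
  \prod_(i < n) (transversal (rev_ord i) (a (rev_ord i)) *
                 transversal (rev_ord i) (b (rev_ord i))) =
  \prod_(i < n) transversal (rev_ord i) (a (rev_ord i) + b (rev_ord i))%R *
  center_of (\sum_(i < n) defect i (a i) (b i))%R.
Proof.
rewrite (reindex_inj rev_ord_inj) center_of_sum -prodgM_commute.
  by apply: eq_bigr => i _; apply: defectE.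
by move=> i j _ _; apply: (center_commute _); apply: center_ofZ.
Qed.

Definition from_coord (x : N2n defect_cocycle) : H :=
  (\prod_(i < n) transversal (rev_ord i) (x.1 (rev_ord i))) * center_of x.2.

Lemma from_coordM : {morph from_coord : x y / x * y}.
Proof.
move=> [a c] [b d]; rewrite /from_coord /=.
rewrite -!mulgA (mulgA (center_of c)) -(center_ofZ c) -!mulgA -center_ofD.
have := prod_descendingM class2 (fun i => transversal i (a i))
  (fun i => transversal i (b i)).
rewrite prod_transversalM prod_transversal_comm mulgA => ->.
rewrite -!mulgA -!center_ofD; congr (_ * center_of _).
  by apply: eq_bigr => i _; rewrite ffunE.
apply/ffunP => p; rewrite !ffunE sum_ffunE /=; ring.
Qed.

Lemma from_coord_std i : from_coord (std_basis defect_cocycle i) = h i.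
Proof.
rewrite /from_coord /= center_of0 mulg1 (big_only1 (rev_ord i)) //.
  by rewrite rev_ordK ffunE eqxx transversal1.
move=> j ji _; rewrite ffunE; case: eqP => [jE|_]; last exact: transversal0.
by rewrite -jE rev_ordK eqxx in ji.
Qed.

Lemma from_coord_bij : bijective from_coord.
Proof.
apply: inj_surj_bijective => [[a c] [b d] abE|x].
  have ab : a = b.
    apply/ffunP => i; apply: (@basis_act_inj i).
    rewrite -2!cosetZ_transversal.
    apply: (basis_dec_uniq bas _ _ _ _ abE (u := fun i => transversal i (a i))
      (u' := fun i => transversal i (b i))); try exact: center_ofZ.
      by move=> j; apply: transversalC.
    by move=> j; apply: transversalC.
  by congr (_, _) => //; move: abE; rewrite ab => /mulgI/center_of_inj.
have [u [v [Cu Zv ->]]] := basis_dec bas x.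
have /choice[r rP] i : exists r : R, cosetZ (u i) = actV r (e i).
  exact/centraliser_scalar.
have /choice[c cP] i : exists c, u i = transversal i (r i) * center_of c.
  exact: transversal_center.
have [d <-] := center_of_surj Zv.
exists ([ffun i => r i], (\sum_(i < n) c (rev_ord i))%R + d)%R.
rewrite /from_coord /= center_ofD mulgA center_of_sum; congr (_ * _).
rewrite -prodgM_commute.
  by apply: eq_bigr => i _; rewrite ffunE cP.
by move=> i j _ _; apply: (center_commute _); apply: center_ofZ.
Qed.

Lemma centraliser_extension i :
  is_extension (defect_cocycle i) (sgtype (centraliser (h i))).
Proof.
pose ext := extension_of (defect_cocycle i).
have xC (x : ext) :
    transversal i x.1 * center_of x.2 \in sgset (centraliser (h i)).
  apply/mem_set/sgM; first exact: transversalC.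
  by apply: centerS_centraliser; apply: center_ofZ.
pose f (x : ext) : sgtype (centraliser (h i)) :=
  exist (fun y => y \in C i) _ (xC x).
have fE x : val (f x) = transversal i x.1 * center_of x.2 by [].
have fM : {morph f : x y / x * y}.
  move=> x y; apply: val_inj; rewrite val_sgM !fE.
  rewrite -!mulgA (mulgA (center_of x.2)) -(center_ofZ x.2) -mulgA -center_ofD.
  rewrite mulgA defectE -mulgA -center_ofD; congr (_ * center_of _).
  by rewrite addrC.
have fbij : bijective f.
  apply: inj_surj_bijective => [[r c] [s d] /(congr1 val)|x].
    rewrite !fE /= => E; have rs : r = s.
      apply: (@basis_act_inj i); rewrite -2!cosetZ_transversal.
      move/(congr1 (@cosetZ H)): E.
      by rewrite !cosetZ_mulr //; apply: center_ofZ.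
    by move: E; rewrite rs => /mulgI/center_of_inj ->.
  have [r /transversal_center[c xE]] :=
    (centraliser_scalar i _).1 (set_mem (valP x)).
  by exists (r, c); apply: val_inj; rewrite fE xE.
have [g [fK gK]] := bij_hom_inv (f := hom_of fM) fbij.
by exists g; exists f.
Qed.

End Construction.

(** * Groups with coordinates in N_{2,n} have a P(f_H)-basis *)

Section Coordinates.
Variables (R : comNzRingType) (n : nat) (f : 'I_n -> sym_cocycle R (pair_sum R n)).
Variables (H : groupType) (h : 'I_n -> H).
Variables (psi : {multiplicative H -> N2n f}) (phi : N2n f -> H).
Hypotheses (psiK : cancel psi phi) (phiK : cancel phi psi).
Hypothesis psih : forall i, psi (h i) = std_basis f i.
Hypothesis hn : (2 <= n)%N.
Local Notation Z := (sgset (center H)).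
Local Notation C i := (sgset (centraliser (h i))).
Local Open Scope ring_scope.

Definition xcoord (x : H) (i : 'I_n) : R := (psi x).1 i.
Definition zcoord (x : H) (p : ltpair n) : R := (psi x).2 p.
Definition of_coord (a : 'I_n -> R) (c : ltpair n -> R) : H :=
  phi ([ffun i => a i], [ffun p => c p]).

Lemma xcoord_of a c i : xcoord (of_coord a c) i = a i.
Proof. by rewrite /xcoord phiK ffunE. Qed.

Lemma zcoord_of a c p : zcoord (of_coord a c) p = c p.
Proof. by rewrite /zcoord phiK ffunE. Qed.

Lemma coord_inj x y : xcoord x =1 xcoord y -> zcoord x =1 zcoord y -> x = y.
Proof.
move=> xy1 xy2; apply: (can_inj psiK).
by rewrite [LHS]surjective_pairing [RHS]surjective_pairing; congr (_, _);
  apply/ffunP.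
Qed.

Lemma xcoordM x y i : xcoord (x * y)%g i = xcoord x i + xcoord y i.
Proof. by rewrite /xcoord gmulfM ffunE. Qed.

Lemma zcoordM x y p : zcoord (x * y)%g p =
  zcoord x p + zcoord y p + xcoord x (val p).1 * xcoord y (val p).2
  + \sum_(k < n) f k (xcoord x k) (xcoord y k) p.
Proof. by rewrite /zcoord gmulfM ffunE. Qed.

Lemma xcoord1 i : xcoord 1%g i = 0.
Proof. by apply: (addrI (xcoord 1%g i)); rewrite -xcoordM mulg1 addr0. Qed.

Lemma xcoordV x i : xcoord x^-1%g i = - xcoord x i.
Proof. by apply: (addIr (xcoord x i)); rewrite -xcoordM mulVg xcoord1 addNr. Qed.

(** A central second factor makes the bilinear and the cocycle terms vanish, so
    that the central coordinates simply add up; in general they do not. *)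
Lemma zcoordMZ x z p : xcoord z =1 (fun=> 0) ->
  zcoord (x * z)%g p = zcoord x p + zcoord z p.
Proof.
move=> z0; rewrite zcoordM z0 mulr0 addr0 big1 ?addr0 // => k _.
by rewrite z0 cocyclex0 ffunE.
Qed.

Lemma zcoord1 p : zcoord 1%g p = 0.
Proof.
apply: (addrI (zcoord 1%g p)); rewrite -zcoordMZ ?mulg1 ?addr0 //.
exact: xcoord1.
Qed.

Lemma xcoordR x y i : xcoord [~ x, y]%g i = 0.
Proof.
apply: (addrI (xcoord (y * x)%g i)); rewrite -xcoordM -commgC addr0.
by rewrite !xcoordM addrC.
Qed.

(** Comparing x y with y x [x, y]: the cocycle terms of x y and of y x agree by
    symmetry, and only the bilinear terms survive. *)
Lemma zcoordR x y p : zcoord [~ x, y]%g p =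
  xcoord x (val p).1 * xcoord y (val p).2 -
  xcoord y (val p).1 * xcoord x (val p).2.
Proof.
apply: (addrI (zcoord (y * x)%g p)); rewrite -zcoordMZ -?commgC; last first.
  exact: xcoordR.
rewrite !zcoordM; under eq_bigr => k _ do rewrite cocycleC.
ring.
Qed.

Lemma xcoord_h i j : xcoord (h i) j = (j == i)%:R.
Proof. by rewrite /xcoord psih ffunE. Qed.

Lemma commute_coord x y : commute x y <-> forall p : ltpair n,
  xcoord x (val p).1 * xcoord y (val p).2 =
  xcoord y (val p).1 * xcoord x (val p).2.
Proof.
split=> [xy p|xy].
  by apply/subr0_eq; rewrite -zcoordR (eqP (introT commgP xy)) zcoord1.
apply/commgP/eqP/coord_inj => [i|p]; first by rewrite xcoordR xcoord1.
by rewrite zcoordR xy subrr zcoord1.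
Qed.

Lemma centraliser_coord i x : C i x <-> forall j, j != i -> xcoord x j = 0.
Proof.
split=> [/commute_coord ix j ji|xi].
  case: (ltngtP i j) => [ij|ij|ij]; last by rewrite (val_inj ij) eqxx in ji.
    have := ix (Sub (i, j) ij); rewrite !SubK /= !xcoord_h eqxx (negPf ji).
    by rewrite mul1r mulr0.
  have := ix (Sub (j, i) ij); rewrite !SubK /= !xcoord_h eqxx (negPf ji).
  by rewrite mulr1 mul0r.
apply/commute_coord => p; rewrite !xcoord_h; have := valP p.
have [->|pi1] := eqVneq (val p).1 i; have [->|pi2] := eqVneq (val p).2 i.
- by rewrite ltnn.
- by rewrite (xi _ pi2) !mulr0.
- by rewrite (xi _ pi1) !mul0r.
- by rewrite !mulr0 mul0r.
Qed.

Lemma exists_other (i : 'I_n) : exists j, j != i.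
Proof.
have [i0|i0] := posnP i.
  by exists (Ordinal hn); apply/eqP => /(congr1 val) /=; rewrite i0.
exists (Ordinal (ltnW hn)); apply/eqP => /(congr1 val) /= E.
by rewrite -E in i0.
Qed.

(** Commuting with h_j for some j <> i forces the i-th coordinate to vanish;
    hence the need for a second index. *)
Lemma center_coord x : Z x <-> forall i, xcoord x i = 0.
Proof.
split=> [Zx i|x0 y].
  have [j ji] := exists_other i.
  have /centraliser_coord : C j x by apply: Zx.
  by apply; rewrite eq_sym.
by apply/commute_coord => p; rewrite !x0 mulr0 mul0r.
Qed.

Lemma coord_class2 (x y : H) : Z [~ x, y]%g.
Proof. by apply/center_coord => i; apply: xcoordR. Qed.

Lemma cosetZ_coord x y : cosetZ x = cosetZ y <-> xcoord x =1 xcoord y.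
Proof.
split=> [/cosetZ_eq/center_coord xy i|xy].
  by apply/esym/subr0_eq; rewrite addrC -xcoordV -xcoordM.
apply/cosetZ_eq/center_coord => i.
by rewrite xcoordM xcoordV xy addNr.
Qed.

(** One computation for the three descriptions of H_ij: the commutators of
    elements of H_i and H_j only have a coordinate at (i, j), the product of the
    i-th and j-th coordinates of the entries, and by the last hypothesis every
    value is reached by a single commutator. *)
Lemma commg_sg_coord (i j : 'I_n) (ij : (i < j)%N) (A B : set H) :
  A `<=` C i -> B `<=` C j ->
  (forall r, exists x y, [/\ A x, B y & xcoord x i * xcoord y j = r]) ->
  commg_sg A B = [set x | Z x /\
    forall p, val p != (i, j) -> zcoord x p = 0] :> set H.
Proof.
move=> AC BC AB; set E := [set x | _].
have EP : is_subgroup E.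
  apply/is_subgroupP; split=> [|x y [Zx x0] [Zy y0]].
    by split=> [|p _]; [exact: sg1 | exact: zcoord1].
  split=> [|p pij]; first exact/sgM/sgV.
  apply: (addIr (zcoord y p)); rewrite -zcoordMZ; last exact/center_coord.
  by rewrite mulgVK x0 // y0 // addr0.
have RE x y : A x -> B y -> E [~ x, y]%g.
  move=> /AC/centraliser_coord xi /BC/centraliser_coord yj.
  split=> [|p pij]; first exact: coord_class2.
  rewrite zcoordR; have := valP p; move: pij; rewrite -pair_eqE /=.
  have [->|pi1] := eqVneq (val p).1 i; have [->|pj2] := eqVneq (val p).2 j => //= _ lp.
  - by rewrite (yj i) ?(yj _ pj2) ?mulr0 ?mul0r ?subr0 // neq_ltn ij.
  - rewrite (xi _ pi1) (xi j) ?mulr0 ?mul0r ?subr0 //.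
    by rewrite neq_ltn ij orbT.
  - rewrite (xi _ pi1) mul0r sub0r.
    have [pi2|pi2] := eqVneq (val p).2 i; last by rewrite xi // mulr0 oppr0.
    rewrite yj ?mul0r ?oppr0 // neq_ltn; apply/orP; left.
    by apply: ltn_trans ij; rewrite -pi2.
apply/seteqP; split; first exact: (@commg_sg_sub H A B (Subgroup EP)).
move=> x [Zx x0]; pose p0 : ltpair n := Sub (i, j) ij.
have [a [b [Aa Bb abx]]] := AB (zcoord x p0).
rewrite (_ : x = [~ a, b]%g); first exact: commg_sg_mem.
have [Zab ab0] := RE a b Aa Bb.
apply: coord_inj => [k|p].
  by rewrite xcoordR; move: k; apply/center_coord.
have [pij|pij] := eqVneq (val p) (i, j); last by rewrite x0 // ab0.
have -> : p = p0 by apply: val_inj; rewrite pij.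
rewrite zcoordR /p0 !SubK /= -abx.
have /centraliser_coord/(_ i) bi := BC b Bb.
by rewrite bi ?mul0r ?subr0 // neq_ltn ij.
Qed.

Definition scaled_basis (i : 'I_n) (r : R) : H :=
  of_coord (fun k => if k == i then r else 0) (fun=> 0).

Lemma xcoord_scaled i r k :
  xcoord (scaled_basis i r) k = if k == i then r else 0.
Proof. exact: xcoord_of. Qed.

Lemma scaled_basisC i r : C i (scaled_basis i r).
Proof.
by apply/centraliser_coord => j /negPf ji; rewrite xcoord_scaled ji.
Qed.

Lemma commg_sg_centralisers (i j : 'I_n) : (i < j)%N ->
  commg_sg (C i) (C j) = [set x | Z x /\
    forall p, val p != (i, j) -> zcoord x p = 0] :> set H.
Proof.
move=> ij; apply: commg_sg_coord => // r.
exists (scaled_basis i 1), (scaled_basis j r).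
by rewrite !xcoord_scaled !eqxx mul1r; split=> //; apply: scaled_basisC.
Qed.

Lemma h_centraliser i : C i (h i).
Proof. by []. Qed.

Lemma xcoord_prod (u : 'I_n -> H) k : (forall i, C i (u i)) ->
  xcoord (\prod_(i < n) u (rev_ord i))%g k = xcoord (u k) k.
Proof.
move=> Cu; rewrite (big_morph (xcoord^~ k) (id1 := 0) (op1 := +%R)); last first.
- exact: xcoord1.
- by move=> x y; apply: xcoordM.
rewrite (reindex_inj rev_ord_inj) (big_only1 k) // => [|i ik _].
  by rewrite rev_ordK.
by rewrite rev_ordK; have /centraliser_coord := Cu i; apply; rewrite eq_sym.
Qed.

Lemma zcoord_prod I (r : seq I) (Q : pred I) (F : I -> H) p :
  (forall i, Q i -> Z (F i)) ->
  zcoord (\prod_(i <- r | Q i) F i)%g p = \sum_(i <- r | Q i) zcoord (F i) p.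
Proof.
move=> ZF; pose K x y := Z x /\ zcoord x p = y.
suff [] : K (\prod_(i <- r | Q i) F i)%g (\sum_(i <- r | Q i) zcoord (F i) p).
  by [].
apply: (big_ind2 K) => [|x a y b [Zx <-] [Zy <-]|i Qi].
- by split; [exact: sg1 | exact: zcoord1].
- by split; [exact: sgM | apply: zcoordMZ; apply/center_coord].
- by split=> //; apply: ZF.
Qed.

Lemma zcoord_prod_pairs (u : 'I_n -> 'I_n -> H) p :
  (forall i j : 'I_n, (i < j)%N -> sgset (commg_sg (C i) (C j)) (u i j)) ->
  zcoord (\prod_(i < n) \prod_(j < n | (i < j)%N) u i j)%g p =
  zcoord (u (val p).1 (val p).2) p.
Proof.
move=> uE; have {}uE (i j : 'I_n) : (i < j)%N -> Z (u i j) /\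
    forall q, val q != (i, j) -> zcoord (u i j) q = 0.
  by move=> ij; have := uE i j ij; rewrite commg_sg_centralisers // => -[].
have Zu (i : 'I_n) : Z (\prod_(j < n | (i < j)%N) u i j)%g.
  by apply: sg_prod => j ij; have [] := uE i j ij.
rewrite zcoord_prod // (big_only1 (val p).1) // => [|i ip _]; rewrite zcoord_prod.
- rewrite (big_only1 (val p).2) ?(valP p) // => j jp pj.
  have [_ -> //] := uE _ _ pj.
  by apply: contraNneq jp => pE; rewrite pE.
- by move=> j pj; have [] := uE _ _ pj.
- apply: big1 => j ij; have [_ -> //] := uE i j ij.
  by apply: contraNneq ip => pE; rewrite pE.
- by move=> j ij; have [] := uE _ _ ij.
Qed.

Lemma coord_is_basis : is_basis h.
Proof.
have hh1 i : h i <> 1%g.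
  by move=> /(congr1 (xcoord^~ i))/eqP; rewrite xcoord_h xcoord1 eqxx oner_eq0.
split=> // [i j /(congr1 (xcoord^~ i))/eqP|].
  by rewrite !xcoord_h eqxx; have [//|_] := eqVneq i j; rewrite oner_eq0.
exists (fun i => centraliser (h i)), (fun i j => commg_sg (C i) (C j)).
split.
- split=> // i j ij; split=> //; rewrite commg_sg_centralisers //;
    apply/esym/commg_sg_coord => //.
  + by move=> _ ->; apply: h_centraliser.
  + move=> r; exists (h i), (scaled_basis j r).
    rewrite xcoord_h xcoord_scaled !eqxx mul1r; split=> //.
    exact: scaled_basisC.
  + by move=> _ ->; apply: h_centraliser.
  + move=> r; exists (scaled_basis i r), (h j).
    rewrite xcoord_h xcoord_scaled !eqxx mulr1; split=> //.
    exact: scaled_basisC.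
- move=> i j ij; apply/seteqP; split=> [x [Cix Cjx]|x Zx]; last first.
    by split; apply: Zx.
  apply/center_coord => k; have [->|ki] := eqVneq k i.
    by move/centraliser_coord: Cjx; apply; rewrite neq_ltn ij.
  by move/centraliser_coord: Cix; apply.
- move=> i; apply/seteqP; split=> [x|_ ->]; last exact: sg1.
  have triv : is_subgroup [set 1%g : H].
    by apply/is_subgroupP; split=> // _ _ -> ->; rewrite mulgV.
  apply: (@commg_sg_sub H (C i) (C i) (Subgroup triv)) => {}x y.
  move=> /centraliser_coord xi /centraliser_coord yi.
  apply/eqP/commgP/commute_coord => p; have := valP p.
  have [->|pi1] := eqVneq (val p).1 i; last first.
    by rewrite (xi _ pi1) (yi _ pi1) !mul0r.
  move=> ip; have pi2 : (val p).2 != i by rewrite neq_ltn ip orbT.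
  by rewrite (xi _ pi2) (yi _ pi2) !mulr0.
- exact: (@commg_sg_sub H setT setT (center H) (fun x y _ _ => coord_class2 x y)).
split.
- move=> x; pose u i := scaled_basis i (xcoord x i).
  have Cu i : C i (u i) by apply: scaled_basisC.
  exists u, ((\prod_(i < n) u (rev_ord i))^-1 * x)%g; split=> //.
    apply/center_coord => k; rewrite xcoordM xcoordV xcoord_prod //.
    by rewrite xcoord_scaled eqxx addNr.
  by rewrite mulVKg.
- move=> x u v u' v' [Cu Zv ->] [Cu' Zv' E] i; apply/cosetZ_coord => j.
  have [->|ji] := eqVneq j i; last first.
    have /centraliser_coord -> // := Cu i.
    by have /centraliser_coord -> // := Cu' i.
  move/(congr1 (xcoord^~ i)): E; rewrite !xcoordM !xcoord_prod //.
  by move/center_coord: Zv => ->; move/center_coord: Zv' => ->; rewrite !addr0.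
- move=> v Zv; pose u (i j : 'I_n) := of_coord (fun=> 0)
    (fun p => if val p == (i, j) then zcoord v p else 0).
  have Eu (i j : 'I_n) : (i < j)%N -> sgset (commg_sg (C i) (C j)) (u i j).
    move=> ij; rewrite commg_sg_centralisers //; split=> [|p /negPf pij].
      by apply/center_coord => k; rewrite xcoord_of.
    by rewrite zcoord_of pij.
  exists u; split=> //; apply: coord_inj => [k|p].
    move/center_coord: (Zv) => ->; apply/esym; move: k; apply/center_coord.
    apply: sg_prod => i _; apply: sg_prod => j ij.
    by have := Eu i j ij; rewrite commg_sg_centralisers // => -[].
  by rewrite zcoord_prod_pairs // zcoord_of -surjective_pairing eqxx.
- move=> v u u' _ [uE ->] [u'E vE] i j ij.
  have := uE i j ij; have := u'E i j ij; rewrite commg_sg_centralisers //.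
  move=> [Zu' u'0] [Zu u0].
  apply: coord_inj => [k|p].
    by move/center_coord: Zu => ->; move/center_coord: Zu' => ->.
  have [pij|pij] := eqVneq (val p) (i, j); last by rewrite u0 ?u'0.
  move/(congr1 (zcoord^~ p)): vE; rewrite !zcoord_prod_pairs //.
  by rewrite pij.
Qed.

(** Multiplying all coordinates by r need not be a homomorphism of H, because
    of the cocycles, but it induces homomorphisms of H / Z(H) and of Z(H), where
    the cocycle terms are absent. *)
Definition homothetyV (r : R) (u : quoZ H) : quoZ H :=
  cosetZ (of_coord (fun i => r * xcoord (repr u) i) (fun=> 0)).

Definition homothetyZ (r : R) (z : sgtype (center H)) : sgtype (center H) :=
  to_center (of_coord (fun=> 0) (fun p => r * zcoord (val z) p)).

Lemma xcoord_repr x : xcoord (repr (cosetZ x)) =1 xcoord x.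
Proof. by apply/cosetZ_coord; rewrite cosetZ_repr. Qed.

Lemma homothetyV_coset r x y : (forall i, xcoord y i = r * xcoord x i) ->
  homothetyV r (cosetZ x) = cosetZ y.
Proof.
by move=> yE; apply/cosetZ_coord => i; rewrite xcoord_of xcoord_repr yE.
Qed.

Lemma homothetyZ_val r z : val (homothetyZ r z) =
  of_coord (fun=> 0) (fun p => r * zcoord (val z) p).
Proof. by apply/to_centerK/center_coord => i; rewrite xcoord_of. Qed.

Lemma homothetyVM r : {morph homothetyV r : u v / (u * v)%g}.
Proof.
move=> u v; have [[x ->] [y ->]] := (cosetZ_surj u, cosetZ_surj v).
rewrite -cosetZM -[RHS]cosetZM; apply: homothetyV_coset => i.
by rewrite !xcoordM !xcoord_of !xcoord_repr mulrDr.
Qed.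

Lemma homothetyZM r : {morph homothetyZ r : u v / (u * v)%g}.
Proof.
move=> z t; apply: val_inj; rewrite val_sgM !homothetyZ_val.
have tZ : xcoord (val t) =1 (fun=> 0) by apply/center_coord/val_center.
apply: coord_inj => [i|p]; first by rewrite xcoordM !xcoord_of addr0.
rewrite zcoordMZ => [|i]; last exact: xcoord_of.
by rewrite !zcoord_of val_sgM zcoordMZ // mulrDr.
Qed.

Lemma homothety_PfH r :
  @PfH H (hom_of (homothetyVM r), hom_of (homothetyZM r)).
Proof.
move=> u v /=; have [[x ->] [y ->]] := (cosetZ_surj u, cosetZ_surj v).
pose rx x' := of_coord (fun i => r * xcoord x' i) (fun=> 0).
have E x' : homothetyV r (cosetZ x') = cosetZ (rx x').
  by apply: homothetyV_coset => i; apply: xcoord_of.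
rewrite !E; split; apply: val_inj; rewrite ?homothetyZ_val.
  rewrite !fH_coset; try exact: coord_class2.
  apply: coord_inj => [i|p]; first by rewrite !xcoordR.
  by rewrite !zcoordR !xcoord_of; ring.
rewrite !fH_coset; try exact: coord_class2.
apply: coord_inj => [i|p]; first by rewrite xcoordR xcoord_of.
by rewrite zcoord_of !zcoordR !xcoord_of; ring.
Qed.

Lemma coord_is_PfH_basis : is_PfH_basis h.
Proof.
split=> [|i]; first exact: coord_is_basis.
apply/seteqP; split=> [_ [x Cx <-]|_ [phi' phiP <-]].
  exists (hom_of (homothetyVM (xcoord x i)), hom_of (homothetyZM (xcoord x i))).
    exact: homothety_PfH.
  apply: homothetyV_coset => j; rewrite xcoord_h.
  have [->|ji] := eqVneq j i; first by rewrite mulr1.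
  by rewrite mulr0; move/centraliser_coord: Cx; apply.
exists (repr (phi'.1 (cosetZ (h i)))); last exact: cosetZ_repr.
apply/commgP/eqP; rewrite -fH_coset ?cosetZ_repr; last exact: coord_class2.
have [_ ->] := phiP (cosetZ (h i)) (cosetZ (h i)).
rewrite [fH _ _](_ : _ = 1%g) ?morphg1 ?val_sg1 //; apply: val_inj.
by rewrite fH_coset ?commgg ?val_sg1 //; apply: coord_class2.
Qed.

End Coordinates.

Theorem theorem6p6 (n : nat) (hn : (2 <= n)%N) (H : groupType) (h : 'I_n -> H) :
  (is_PfH_basis h <->
   exists (R : comNzRingType) (f : 'I_n -> sym_cocycle R (pair_sum R n))
          (phi : {multiplicative N2n f -> H}),
     bijective phi /\ (forall i, phi (std_basis f i) = h i)) /\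
  (is_PfH_basis h ->
   exists (R : comNzRingType) (f : 'I_n -> sym_cocycle R (pair_sum R n))
          (phi : {multiplicative N2n f -> H}),
     [/\ bijective phi, (forall i, phi (std_basis f i) = h i) &
         forall i, is_extension (f i) (sgtype (centraliser (h i)))]).
Proof.
have coord : is_PfH_basis h ->
    exists (R : comNzRingType) (f : 'I_n -> sym_cocycle R (pair_sum R n))
           (phi : {multiplicative N2n f -> H}),
      [/\ bijective phi, (forall i, phi (std_basis f i) = h i) &
          forall i, is_extension (f i) (sgtype (centraliser (h i)))].
  move=> hb; have ntH := basis_nontrivial hb.1 (Ordinal hn).
  exists (PfH_ring (basis_center_comm hb.1) ntH), (defect_cocycle hb ntH).
  exists (hom_of (@from_coordM _ _ _ hb ntH)); split.
  - exact: from_coord_bij.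
  - exact: from_coord_std.
  - exact: centraliser_extension.
split=> //; split=> [/coord[R [f [phi [phib phih _]]]]|].
  by exists R, f, phi.
case=> R [f [phi [phib phih]]]; have [psi [phiK psiK]] := bij_hom_inv phib.
by apply: (coord_is_PfH_basis psiK phiK) => // i; rewrite -phih phiK.
Qed.
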